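(* Let $((W_n,H_n))_{n\in\mathbb{N}}$ be a sequence generated by the fixed point algorithm for NMF (described in the context) from initial points $H_0\in\mathbb{R}_+^{R\times N}$, $W_0\in\mathbb{R}_+^{M\times R}$, with associated mappings $T_n$, $S_n$ and parameters $(\alpha_n)$, $(\beta_n)$, $(\mu_n)$, $(\lambda_n)$. Suppose that: (A) there exists $m_0\in\mathbb{N}$ such that $\bigcap_{n=m_0}^\infty \mathrm{Fix}(S_n)\neq\emptyset$ and $\bigcap_{n=m_0}^\infty \mathrm{Fix}(T_n)\neq\emptyset$; (C1) $0<\liminf_{n\to\infty}\alpha_n\le\limsup_{n\to\infty}\alpha_n<1$ and $0<\liminf_{n\to\infty}\beta_n\le\limsup_{n\to\infty}\beta_n<1$; (C2) $0<\liminf_{n\to\infty}\mu_n$ and $0<\liminf_{n\to\infty}\lambda_n$. Then any accumulation point of the sequence $((W_n,H_n))_{n\in\mathbb{N}}$ belongs to $\mathrm{VI}(C,\nabla f)$.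
   Context: $\mathbb{N}$ includes zero. $M,N,R$ are positive integers with $1\le R<\min\{M,N\}$, and $V\in\mathbb{R}_+^{M\times N}$ is a given matrix, where $\mathbb{R}_+^{m\times n}$ denotes the set of entrywise nonnegative real $m\times n$ matrices. $O$ is the zero matrix. For matrices $X,Y\in\mathbb{R}^{m\times n}$, $X\bullet Y:=\sum_{i,j}X_{ij}Y_{ij}$ and $\|X\|_{\mathrm F}:=\sqrt{X\bullet X}$. On $\mathbb{R}^{M\times R}\times\mathbb{R}^{R\times N}$ the inner product is $\langle (X_1,Y_1),(X_2,Y_2)\rangle:=X_1\bullet X_2+Y_1\bullet Y_2$. $P_K$ denotes the metric projection (w.r.t. $\|\cdot\|_{\mathrm F}$) onto a nonempty closed convex set $K$. $\mathrm{Fix}(T):=\{x : T(x)=x\}$. Let $f(W,H):=\frac12\|V-WH\|_{\mathrm F}^2$ for $(W,H)\in\mathbb{R}^{M\times R}\times\mathbb{R}^{R\times N}$, with $\nabla_W f(W,H)=(WH-V)H^\top$, $\nabla_H f(W,H)=W^\top(WH-V)$ and $\nabla f=(\nabla_W f,\nabla_H f)$. Let $C:=\mathbb{R}_+^{M\times R}\times\mathbb{R}_+^{R\times N}$ and $$\mathrm{VI}(C,\nabla f):=\{X^\star\in C:\langle X-X^\star,\nabla f(X^\star)\rangle\ge 0\ \text{ for all } X\in C\}.$$ Fixed point algorithm for NMF. Given $(\alpha_n)_{n\in\mathbb{N}},(\beta_n)_{n\in\mathbb{N}}\subset[0,1]$, $H_0\in\mathbb{R}_+^{R\times N}$ and $W_0\in\mathbb{R}_+^{M\times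 R}$, for $n=0,1,2,\dots$ (the iteration is run indefinitely): 1. Choose $\mu_n\in\left(0,\frac{2}{\|W_n^\top W_n\|_{\mathrm F}}\right]$ if $W_n\ne O$, and any $\mu_n\in(0,\infty)$ if $W_n=O$. Let $T_n:\mathbb{R}^{R\times N}\to\mathbb{R}^{R\times N}$ be $T_n(H):=P_{\mathbb{R}_+^{R\times N}}[H-\mu_n W_n^\top(W_nH-V)]$ (when $W_n=O$ this is $P_{\mathbb{R}_+^{R\times N}}(H)$, so $T_n(H_n)=H_n$). 2. Set $H_{n+1}:=\alpha_nH_n+(1-\alpha_n)T_n(H_n)$. 3. Choose $\lambda_n\in\left(0,\frac{2}{\|H_{n+1}^\top H_{n+1}\|_{\mathrm F}}\right]$ if $H_{n+1}\ne O$, and any $\lambda_n\in(0,\infty)$ if $H_{n+1}=O$. Let $S_n:\mathbb{R}^{M\times R}\to\mathbb{R}^{M\times R}$ be $S_n(W):=P_{\mathbb{R}_+^{M\times R}}[W-\lambda_n(WH_{n+1}-V)H_{n+1}^\top]$ (when $H_{n+1}=O$, $S_n(W_n)=W_n$). 4. Set $W_{n+1}:=\beta_nW_n+(1-\beta_n)S_n(W_n)$. *)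

(* Defs.v *)
From HB Require Import structures.
From mathcomp Require Import all_boot all_order all_algebra.
From mathcomp Require Import all_classical all_reals all_analysis.

Set Implicit Arguments.
Unset Strict Implicit.
Unset Printing Implicit Defensive.

Import Order.TTheory GRing.Theory Num.Theory.
Import numFieldNormedType.Exports.

Local Open Scope classical_set_scope.
Local Open Scope ring_scope.

(* 'M_(m, n) and products of such spaces carry the sup norm in the library;
   it induces the same topology as the Frobenius norm. *)

Definition frob_dot (R : realType) (m n : nat) (X Y : 'M[R]_(m, n)) : R :=
  \sum_i \sum_j X i j * Y i j.

Definition frob_norm (R : realType) (m n : nat) (X : 'M[R]_(m, n)) : R :=
  Num.sqrt (frob_dot X X).

Definition pair_dot (R : realType) (m n p q : nat)
    (X Y : 'M[R]_(m, n) * 'M[R]_(p, q)) : R :=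
  frob_dot X.1 Y.1 + frob_dot X.2 Y.2.

Definition nonneg_mx (R : realType) (m n : nat) : set 'M[R]_(m, n) :=
  [set X | forall i j, 0 <= X i j].

(* A nearest point of K exists and is unique when K is nonempty, closed and
   convex; otherwise the default value 0 may be returned. *)
Definition metric_proj (R : realType) (m n : nat) (K : set 'M[R]_(m, n))
    (X : 'M[R]_(m, n)) : 'M[R]_(m, n) :=
  xget 0 [set P | K P /\
            forall Q, K Q -> frob_norm (X - P) <= frob_norm (X - Q)].

Definition fixed_points (T : Type) (F : T -> T) : set T := [set x | F x = x].

Definition VI (R : realType) (m n p q : nat)
    (C : set ('M[R]_(m, n) * 'M[R]_(p, q)))
    (A : 'M[R]_(m, n) * 'M[R]_(p, q) -> 'M[R]_(m, n) * 'M[R]_(p, q)) :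
    set ('M[R]_(m, n) * 'M[R]_(p, q)) :=
  [set Xs | C Xs /\ forall X, C X -> 0 <= pair_dot (X - Xs) (A Xs)].

Section NMF.
Context (R : realType) (M N r : nat) (V : 'M[R]_(M, N)).

Definition nmf_obj (X : 'M[R]_(M, r) * 'M[R]_(r, N)) : R :=
  2^-1 * frob_norm (V - X.1 *m X.2) ^+ 2.

Definition nmf_gradW (W : 'M[R]_(M, r)) (H : 'M[R]_(r, N)) : 'M[R]_(M, r) :=
  (W *m H - V) *m H^T.

Definition nmf_gradH (W : 'M[R]_(M, r)) (H : 'M[R]_(r, N)) : 'M[R]_(r, N) :=
  W^T *m (W *m H - V).

Definition nmf_grad (X : 'M[R]_(M, r) * 'M[R]_(r, N)) :
    'M[R]_(M, r) * 'M[R]_(r, N) :=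
  (nmf_gradW X.1 X.2, nmf_gradH X.1 X.2).

Lemma is_derive_nmf_obj (X D : 'M[R]_(M, r) * 'M[R]_(r, N)) :
  is_derive X D nmf_obj (pair_dot D (nmf_grad X)).
Proof.
have lin (g : 'M[R]_(M, r) * 'M[R]_(r, N) -> R) :
    (forall h : R, g (h *: D + X) = h * g D + g X) -> is_derive X D g (g D).
  move=> gl; have q : (fun h : R => h^-1 *: ((g \o shift X) (h *: D) - g X))
                        @ 0^' --> g D.
    apply: cvg_near_cst; near=> h.
    have h0 : h != 0 by near: h; exact: nbhs_dnbhs_neq.
    by rewrite /= gl addrK scalerA mulVf ?scale1r.
  by apply: DeriveDef; [apply/cvg_ex; exists (g D) | exact: cvg_lim].
pose p1 i k (Y : 'M[R]_(M, r) * 'M[R]_(r, N)) : R := Y.1 i k.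
pose p2 k j (Y : 'M[R]_(M, r) * 'M[R]_(r, N)) : R := Y.2 k j.
have c1 i k : is_derive X D (p1 i k) (D.1 i k).
  by apply: (lin (p1 i k)) => h; rewrite /p1 /= !mxE.
have c2 k j : is_derive X D (p2 k j) (D.2 k j).
  by apply: (lin (p2 k j)) => h; rewrite /p2 /= !mxE.
pose e i j (Y : 'M[R]_(M, r) * 'M[R]_(r, N)) : R := V i j - \sum_k (Y.1 i k * Y.2 k j).
pose de i j := - \sum_k (X.1 i k * D.2 k j + X.2 k j * D.1 i k).
have de_e i j : is_derive X D (e i j) (de i j).
  have -> : e i j = cst (V i j) - \sum_k (p1 i k * p2 k j).
    by apply/funext => Y; rewrite /e !fctE fct_sumE.
  by apply: is_derive_eq; rewrite sub0r.
have objE : nmf_obj = 2^-1 *: \sum_i \sum_j (e i j * e i j).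
  apply/funext => Y; rewrite /nmf_obj sqr_sqrtr; last first.
    by apply: sumr_ge0 => i _; apply: sumr_ge0 => j _; rewrite -expr2 sqr_ge0.
  rewrite !fctE fct_sumE; congr (_ * _); apply: eq_bigr => i _.
  by rewrite fct_sumE; apply: eq_bigr => j _; rewrite !mxE.
rewrite objE; apply: is_derive_eq.
have trE m n (A B : 'M[R]_(m, n)) : frob_dot A B = \tr (A *m B^T).
  by apply: eq_bigr => i _; rewrite mxE; apply: eq_bigr => j _; rewrite mxE.
have -> : pair_dot D (nmf_grad X) =
    frob_dot (D.1 *m X.2 + X.1 *m D.2) (X.1 *m X.2 - V).
  rewrite /pair_dot !trE /= /nmf_gradW /nmf_gradH.
  set E := X.1 *m X.2 - V.
  rewrite mulmxDl mxtraceD !trmx_mul !trmxK -mulmxA; congr (_ + _).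
  by rewrite mulmxA mxtrace_mulC mulmxA.
rewrite /frob_dot scaler_sumr; apply: eq_bigr => i _.
rewrite scaler_sumr; apply: eq_bigr => j _.
have half (a : R) : 2^-1 *: (a + a) = a.
  by rewrite -mulr2n -[a *+ 2]mulr_natl scalerA mulVf ?pnatr_eq0// scale1r.
rewrite half -[LHS]/(e i j X * de i j) mulrC /de /e mulNr -mulrN opprB !mxE.
by rewrite big_split addrC; congr ((_ + _) * _); apply: eq_bigr => k _; rewrite mulrC.
Unshelve. all: by end_near. Qed.

Definition nmf_T (mu : R) (W : 'M[R]_(M, r)) (H : 'M[R]_(r, N)) :
    'M[R]_(r, N) :=
  metric_proj (@nonneg_mx R r N) (H - mu *: nmf_gradH W H).

Definition nmf_S (lambda : R) (H : 'M[R]_(r, N)) (W : 'M[R]_(M, r)) :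
    'M[R]_(M, r) :=
  metric_proj (@nonneg_mx R M r) (W - lambda *: nmf_gradW W H).

End NMF.

Definition step_size (R : realType) (m n : nat) (A : 'M[R]_(m, n)) (s : R) :
    Prop :=
  if A == 0 then 0 < s else 0 < s <= 2 / frob_norm (A^T *m A).

Record nmf_fixed_point_algorithm (R : realType) (M N r : nat)
    (V : 'M[R]_(M, N)) (alpha beta mu lambda : nat -> R)
    (W : nat -> 'M[R]_(M, r)) (H : nat -> 'M[R]_(r, N)) : Prop := {
  nmf_alpha01 : forall n, 0 <= alpha n <= 1;
  nmf_beta01 : forall n, 0 <= beta n <= 1;
  nmf_H0 : nonneg_mx (H 0%N);
  nmf_W0 : nonneg_mx (W 0%N);
  nmf_mu : forall n, step_size (W n) (mu n);
  nmf_H : forall n,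
    H n.+1 = alpha n *: H n + (1 - alpha n) *: nmf_T V (mu n) (W n) (H n);
  nmf_lambda : forall n, step_size (H n.+1) (lambda n);
  nmf_W : forall n,
    W n.+1 = beta n *: W n
             + (1 - beta n) *: nmf_S V (lambda n) (H n.+1) (W n)
}.

(* Main.v *)
(* The step size bound makes I - s A^T A a contraction for the Frobenius norm
   (|A^T E|^2 <= |A^T A| |E|^2), so T_n and S_n are nonexpansive.  With a common
   fixed point, the Krasnosel'skii-Mann argument (relaxation parameters bounded
   away from 0 and 1) gives H_n - T_n(H_n) -> 0 and W_n - S_n(W_n) -> 0; in
   particular H_(n+1) - H_n -> 0.  The obtuse-angle characterization of the
   projection reads
     mu_n <Q - T_n(H_n), grad_H f(W_n, H_n)> >= <Q - T_n(H_n), H_n - T_n(H_n)>,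
   and similarly for W_n; dividing by step sizes bounded away from 0 and passing
   to the limit along a subsequence gives the two halves of the variational
   inequality. *)

Require Import Defs.
From HB Require Import structures.
From mathcomp Require Import all_boot all_order all_algebra.
From mathcomp Require Import all_classical all_reals all_analysis.
From mathcomp Require Import ring lra.

Set Implicit Arguments.
Unset Strict Implicit.
Unset Printing Implicit Defensive.

Import Order.TTheory GRing.Theory Num.Theory.
Import numFieldNormedType.Exports.

Local Open Scope classical_set_scope.
Local Open Scope ring_scope.

(** * Frobenius inner product and nonexpansiveness of gradient steps *)

Section frobenius.
Context {R : realType}.

Lemma frob_dot_tr m n (A B : 'M[R]_(m, n)) : frob_dot A B = \tr (A *m B^T).
Proof.
by apply: eq_bigr => i _; rewrite mxE; apply: eq_bigr => j _; rewrite mxE.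
Qed.

Lemma frob_dotC m n (A B : 'M[R]_(m, n)) : frob_dot A B = frob_dot B A.
Proof. by apply: eq_bigr => i _; apply: eq_bigr => j _; rewrite mulrC. Qed.

Lemma frob_dotDl m n (A B C : 'M[R]_(m, n)) :
  frob_dot (A + B) C = frob_dot A C + frob_dot B C.
Proof. by rewrite !frob_dot_tr mulmxDl mxtraceD. Qed.

Lemma frob_dotZl m n a (A B : 'M[R]_(m, n)) :
  frob_dot (a *: A) B = a * frob_dot A B.
Proof. by rewrite !frob_dot_tr -scalemxAl mxtraceZ. Qed.

Lemma frob_dotNl m n (A B : 'M[R]_(m, n)) : frob_dot (- A) B = - frob_dot A B.
Proof. by rewrite -scaleN1r frob_dotZl mulN1r. Qed.

Lemma frob_dotDr m n (A B C : 'M[R]_(m, n)) :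
  frob_dot A (B + C) = frob_dot A B + frob_dot A C.
Proof. by rewrite frob_dotC frob_dotDl !(frob_dotC A). Qed.

Lemma frob_dotZr m n a (A B : 'M[R]_(m, n)) :
  frob_dot A (a *: B) = a * frob_dot A B.
Proof. by rewrite frob_dotC frob_dotZl frob_dotC. Qed.

Lemma frob_dotNr m n (A B : 'M[R]_(m, n)) : frob_dot A (- B) = - frob_dot A B.
Proof. by rewrite frob_dotC frob_dotNl frob_dotC. Qed.

Definition frob_dotE :=
  (frob_dotDl, frob_dotDr, frob_dotNl, frob_dotNr, frob_dotZl,
   frob_dotZr).

Lemma frob_dot_ge0 m n (A : 'M[R]_(m, n)) : 0 <= frob_dot A A.
Proof.
by apply: sumr_ge0 => i _; apply: sumr_ge0 => j _; rewrite -expr2 sqr_ge0.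
Qed.

Lemma sqr_entry_le_frob m n (A : 'M[R]_(m, n)) i j :
  A i j ^+ 2 <= frob_dot A A.
Proof.
rewrite /frob_dot (bigD1 i)//= (bigD1 j)//= -expr2 -addrA lerDl addr_ge0//.
  by apply: sumr_ge0 => k _; rewrite -expr2 sqr_ge0.
by apply: sumr_ge0 => l _; apply: sumr_ge0 => k _; rewrite -expr2 sqr_ge0.
Qed.

Lemma frob_dot_trmx m n (A B : 'M[R]_(m, n)) :
  frob_dot A^T B^T = frob_dot A B.
Proof. by rewrite frob_dotC !frob_dot_tr trmxK mxtrace_mulC. Qed.

Lemma frob_dot_mulmxl m n p (A : 'M[R]_(m, n)) (B : 'M[R]_(n, p))
    (C : 'M[R]_(m, p)) :
  frob_dot (A *m B) C = frob_dot B (A^T *m C).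
Proof.
by rewrite !frob_dot_tr -mulmxA mxtrace_mulC trmx_mul trmxK mulmxA.
Qed.

(** Up to cyclic permutation, both sides are the trace of the same alternating product of [A] and
    [A^T]. This lets the step size bound pass to the transpose. *)
Lemma frob_dot_mul_tr m n (A : 'M[R]_(m, n)) :
  frob_dot (A *m A^T) (A *m A^T) = frob_dot (A^T *m A) (A^T *m A).
Proof.
by rewrite !frob_dot_tr !trmx_mul !trmxK -mulmxA mxtrace_mulC !mulmxA.
Qed.

(** Lagrange's identity: the double sum of the squares [(a i * b j - a j * b i) ^+ 2] is twice the
    gap between the two sides. *)
Lemma sum_sqr_cauchy_schwarz (I : finType) (a b : I -> R) :
  (\sum_i a i * b i) ^+ 2 <= (\sum_i a i * a i) * (\sum_i b i * b i).
Proof.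
have : 0 <= \sum_i \sum_j (a i * b j - a j * b i) ^+ 2.
  by apply: sumr_ge0 => i _; apply: sumr_ge0 => j _; rewrite sqr_ge0.
have -> : \sum_i \sum_j (a i * b j - a j * b i) ^+ 2 =
    \sum_i \sum_j (a i * a i * (b j * b j)) +
    \sum_i \sum_j (b i * b i * (a j * a j)) -
    2 * \sum_i \sum_j (a i * b i * (a j * b j)).
  rewrite mulr_sumr -sumrN -!big_split; apply: eq_bigr => i _ /=.
  rewrite mulr_sumr -sumrN -!big_split; apply: eq_bigr => j _ /=.
  ring.
rewrite -!big_distrlr /= expr2; nra.
Qed.

Lemma frob_dot_cauchy_schwarz m n (A B : 'M[R]_(m, n)) :
  frob_dot A B ^+ 2 <= frob_dot A A * frob_dot B B.
Proof.
rewrite /frob_dot !pair_bigA /=.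
exact: (sum_sqr_cauchy_schwarz (fun p => A p.1 p.2) (fun p => B p.1 p.2)).
Qed.

(** Each entry of [A *m B] pairs a row of [A] with a column of [B], so Cauchy-Schwarz applies entry
    by entry. *)
Lemma frob_dot_mulmx_le m n p (A : 'M[R]_(m, n)) (B : 'M[R]_(n, p)) :
  frob_dot (A *m B) (A *m B) <= frob_dot A A * frob_dot B B.
Proof.
have -> : frob_dot B B = \sum_j \sum_i B i j * B i j by rewrite exchange_big.
rewrite big_distrlr /=; apply: ler_sum => i _; apply: ler_sum => j _.
by rewrite mxE -expr2; exact: sum_sqr_cauchy_schwarz.
Qed.

(** Cauchy-Schwarz and submultiplicativity give [|A^T B|^2 = <B, A A^T B> <= |A A^T| |B|^2], and
    [|A A^T| = |A^T A|]. Both sides are squared first to remove the root in [frob_norm]. *)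
Lemma frob_dot_trmx_mulmx_le m n p (A : 'M[R]_(m, n)) (B : 'M[R]_(m, p)) :
  frob_dot (A^T *m B) (A^T *m B) <= frob_norm (A^T *m A) * frob_dot B B.
Proof.
rewrite -(ler_sqr (frob_dot_ge0 _)) ?nnegrE; last first.
  by rewrite mulr_ge0 ?sqrtr_ge0 ?frob_dot_ge0.
rewrite exprMn sqr_sqrtr ?frob_dot_ge0// {1}frob_dot_mulmxl trmxK mulmxA.
apply: le_trans (frob_dot_cauchy_schwarz _ _) _.
rewrite mulrC expr2 mulrA ler_wpM2r ?frob_dot_ge0// -frob_dot_mul_tr.
exact: frob_dot_mulmx_le.
Qed.

(** With [G = A^T A D], the left side is [|D|^2 - 2 s |A D|^2 + s^2 |G|^2]. The correction is
    nonpositive since [|G|^2 <= |A^T A| |A D|^2] and [s |A^T A| <= 2]; for [A = 0] it vanishes. *)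
Lemma gradient_step_contraction m n p (A : 'M[R]_(m, n)) (D : 'M[R]_(n, p)) s :
  step_size A s ->
  frob_dot (D - s *: (A^T *m (A *m D))) (D - s *: (A^T *m (A *m D)))
  <= frob_dot D D.
Proof.
rewrite /step_size; case: ifPn => [/eqP ->|A0 /andP[s0 sA]].
  by rewrite mul0mx mulmx0 scaler0 subr0.
set G := A^T *m (A *m D).
have DG : frob_dot D G = frob_dot (A *m D) (A *m D) by rewrite -frob_dot_mulmxl.
rewrite !frob_dotE (frob_dotC G) DG.
have GG := frob_dot_trmx_mulmx_le A (A *m D); rewrite -/G in GG.
have s2 : s * frob_norm (A^T *m A) <= 2.
  have [?|A1] := ltP 0 (frob_norm (A^T *m A)); first by rewrite -ler_pdivlMr.
  have /eqP -> : frob_norm (A^T *m A) == 0 by rewrite eq_le A1 sqrtr_ge0.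
  by rewrite mulr0.
have := frob_dot_ge0 (A *m D).
set F := frob_norm _ in GG s2; set d := frob_dot (A *m D) _ in GG *.
set g := frob_dot G G in GG * => d0.
have sg : s * g <= 2 * d.
  apply: le_trans (_ : s * (F * d) <= _); first by rewrite ler_pM2l.
  by rewrite mulrA ler_wpM2r.
nra.
Qed.

End frobenius.

(** * Metric projection onto the nonnegative matrices *)

Section projection.
Context {R : realType} {m n : nat}.
Implicit Types X P Q : 'M[R]_(m, n).

Lemma metric_proj_nonnegP X : let P := metric_proj (@nonneg_mx R m n) X in
  nonneg_mx P /\ forall Q, nonneg_mx Q -> frob_dot (X - P) (Q - P) <= 0.
Proof.
rewrite /metric_proj; set S := [set P | _]; set P := xget 0 S.
have [P0 Pmin] : S P.
  (* To rule out the default value of [xget], a nearest point is exhibited: the entrywise positive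
     part of [X]. *)
  apply: xgetPex; exists (map_mx (Num.max 0) X); split.
    by move=> i j; rewrite mxE le_max lexx.
  move=> Q Q0; rewrite ler_wsqrtr//; apply: ler_sum => i _.
  apply: ler_sum => j _; rewrite !mxE; have := Q0 i j.
  case: (leP 0 (X i j)) => [_ _|X0 Q0'].
    by rewrite subrr mulr0 -expr2 sqr_ge0.
  nra.
split => // Q Q0; rewrite leNgt; apply/negP => d0.
set d := frob_dot _ _ in d0; pose e := frob_dot (Q - P) (Q - P).
have e0 : 0 <= e := frob_dot_ge0 _.
(* the segment from [P] to [Q] would first move closer to [X] *)
pose t := d / (d + e).
have t0 : 0 < t by rewrite divr_gt0// ltr_pwDl.
have t1 : t <= 1 by rewrite ler_pdivrMr ?ltr_pwDl// mul1r lerDl.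
(* Moving by [t] changes the squared distance to [X] by [t * (t * e - 2 * d)], which this makes
   negative. The denominator [d + e] also keeps [t <= 1] and stays positive when [e = 0]. *)
have te : t * e < 2 * d.
  by rewrite /t mulrAC ltr_pdivrMr ?ltr_pwDl//; nra.
have : frob_norm (X - P) <= frob_norm (X - (P + t *: (Q - P))).
  apply: Pmin => i j; rewrite !mxE.
  have := P0 i j; have := Q0 i j; nra.
rewrite /frob_norm ler_sqrt ?frob_dot_ge0// opprD addrA.
rewrite !(frob_dotDl (X - P)) !(frob_dotDr _ (X - P)) !frob_dotNl !frob_dotNr.
rewrite !frob_dotZl !frob_dotZr (frob_dotC (Q - P) (X - P)) -/d -/e.
nra.
Qed.

(** Let [P], [Q] be the projections of [X], [Y]. Testing each obtuse-angle inequality at the other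
    projection and adding gives [<X - Y - (P - Q), P - Q> >= 0]. Then [|X - Y|^2] is [|P - Q|^2]
    plus twice this term plus [|X - Y - (P - Q)|^2]. *)
Lemma metric_proj_nonneg_contraction X Y :
  frob_dot (metric_proj (@nonneg_mx R m n) X - metric_proj (@nonneg_mx R m n) Y)
           (metric_proj (@nonneg_mx R m n) X - metric_proj (@nonneg_mx R m n) Y)
  <= frob_dot (X - Y) (X - Y).
Proof.
have [/=] := metric_proj_nonnegP X; set P := metric_proj _ X => P0 PX.
have [/=] := metric_proj_nonnegP Y; set Q := metric_proj _ Y => Q0 QY.
have := PX _ Q0; have := QY _ P0.
have := frob_dot_ge0 (X - Y - (P - Q)).
rewrite !frob_dotE.
rewrite (frob_dotC Q P) (frob_dotC Y X) (frob_dotC P X) (frob_dotC Q X).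
rewrite (frob_dotC P Y) (frob_dotC Q Y); lra.
Qed.

End projection.

(** * Limits of sequences, and asymptotics of relaxed and projected iterations *)

Section limits.
Context {R : realType}.

Lemma limn_esup_lt_near (u : nat -> R) (c : R) :
  (limn_esup (EFin \o u) < c%:E)%E ->
  exists2 b, b < c & \forall n \near \oo, u n <= b.
Proof.
rewrite /limn_esup /limf_esup => /ereal_inf_lt[_ [A Aoo <-]] lec.
have uA n : A n -> ((u n)%:E <= ereal_sup [set (EFin \o u) k | k in A])%E.
  by move=> An; apply: ereal_sup_ubound; exists n.
move: uA lec; case: ereal_sup => [b| |] uA //.
  rewrite lte_fin => bc; exists b => //; apply: filterS Aoo => n /uA.
  by rewrite lee_fin.
(* A supremum equal to [-oo] forces [A] to be empty, so any number below [c] serves as bound. *)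
move=> _; exists (c - 1); first by rewrite ltrBlDr ltrDl.
by apply: filterS Aoo => n /uA.
Qed.

Lemma limn_einf_gt_near (u : nat -> R) (c : R) :
  (c%:E < limn_einf (EFin \o u))%E ->
  exists2 b, c < b & \forall n \near \oo, b <= u n.
Proof.
rewrite /limn_einf lteNr => /(@limn_esup_lt_near (fun n => - u n) (- c))[b bc].
move=> ub; exists (- b); first by rewrite ltrNr.
by apply: filterS ub => n; rewrite lerNl.
Qed.

(** Working with entries reduces limits of matrix expressions to limits of finite sums and products
    of reals, whatever the matrix norm. *)
Definition entrywise_cvg m n (A : nat -> 'M[R]_(m, n)) (B : 'M[R]_(m, n)) :=
  forall i j, A k i j @[k --> \oo] --> B i j.

Lemma entrywise_cvg_cst m n (A : 'M[R]_(m, n)) : entrywise_cvg (fun=> A) A.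
Proof. by move=> i j; exact: cvg_cst. Qed.

Lemma entrywise_cvgD m n (A A' : nat -> 'M[R]_(m, n)) B B' :
  entrywise_cvg A B -> entrywise_cvg A' B' ->
  entrywise_cvg (fun k => A k + A' k) (B + B').
Proof.
by move=> AB AB' i j; rewrite mxE; under eq_fun do rewrite mxE; apply: cvgD.
Qed.

Lemma entrywise_cvgB m n (A A' : nat -> 'M[R]_(m, n)) B B' :
  entrywise_cvg A B -> entrywise_cvg A' B' ->
  entrywise_cvg (fun k => A k - A' k) (B - B').
Proof.
move=> AB AB' i j; rewrite !mxE; under eq_fun do rewrite !mxE.
by apply: cvgB.
Qed.

Lemma entrywise_cvg_trmx m n (A : nat -> 'M[R]_(m, n)) B :
  entrywise_cvg A B -> entrywise_cvg (fun k => (A k)^T) B^T.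
Proof.
by move=> AB i j; rewrite mxE; under eq_fun do rewrite mxE; exact: AB.
Qed.

Lemma cvg_sum_fin (I : finType) (f : I -> nat -> R) (l : I -> R) :
  (forall i, f i k @[k --> \oo] --> l i) ->
  (\sum_i f i k) @[k --> \oo] --> \sum_i l i.
Proof.
move=> fl; apply: cvg_big => [|i _]; last exact: fl.
exact: add_continuous.
Qed.

Lemma entrywise_cvg_mulmx m n p (A : nat -> 'M[R]_(m, n))
    (B : nat -> 'M[R]_(n, p)) A' B' :
  entrywise_cvg A A' -> entrywise_cvg B B' ->
  entrywise_cvg (fun k => A k *m B k) (A' *m B').
Proof.
move=> AA BB i j; rewrite mxE; under eq_fun do rewrite mxE.
by apply: cvg_sum_fin => l; apply: cvgM.
Qed.

Lemma cvg_frob_dot m n (A B : nat -> 'M[R]_(m, n)) A' B' :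
  entrywise_cvg A A' -> entrywise_cvg B B' ->
  frob_dot (A k) (B k) @[k --> \oo] --> frob_dot A' B'.
Proof.
by move=> AA BB; do 2!(apply: cvg_sum_fin => ?); apply: cvgM.
Qed.

Lemma entrywise_cvg_comp m n (A : nat -> 'M[R]_(m, n)) B (phi : nat -> nat) :
  phi k @[k --> \oo] --> \oo -> entrywise_cvg A B ->
  entrywise_cvg (A \o phi) B.
Proof. by move=> phioo AB i j; apply: cvg_comp (AB i j). Qed.

Lemma cvg_entrywise m n (A : nat -> 'M[R]_(m, n)) B :
  A k @[k --> \oo] --> B -> entrywise_cvg A B.
Proof.
move=> AB i j.
exact: (@cvg_comp _ _ _ A (fun C : 'M[R]_(m, n) => C i j) _ _ _ AB
  (@coord_continuous _ _ _ i j B)).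
Qed.

Lemma cvg_frob_entrywise0 m n (A : nat -> 'M[R]_(m, n)) :
  frob_dot (A k) (A k) @[k --> \oo] --> 0 -> entrywise_cvg A 0.
Proof.
move=> A0 i j; rewrite mxE; apply/cvgr0Pnorm_lt => e e0.
have : \forall k \near \oo, frob_dot (A k) (A k) < e ^+ 2.
  by apply: cvgr_lt A0 _ _; rewrite exprn_gt0.
apply: filterS => k Ae.
rewrite -ltr_sqr ?nnegrE ?(ltW e0)// real_normK ?num_real//.
exact: le_lt_trans (sqr_entry_le_frob _ _ _) Ae.
Qed.

(** For each [k], clustering yields an index at least [k] whose term lies within [1 / (k + 1)] of
    [x]. The resulting [phi] tends to infinity but may fail to be increasing. *)
Lemma cluster_cvg_subseq (U : pseudoMetricType R) (u : nat -> U) x :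
  cluster (u @ \oo) x ->
  exists2 phi : nat -> nat,
    phi k @[k --> \oo] --> \oo & u (phi k) @[k --> \oo] --> x.
Proof.
move=> ux.
have /choice[phi phiP] (k : nat) :
    exists l : nat, (k <= l)%N /\ ball x k.+1%:R^-1 (u l).
  have := ux (u @` [set l | (k <= l)%N]) (ball x k.+1%:R^-1).
  case.
  - by exists k => // l /= kl; exists l.
  - by apply: nbhsx_ballx; rewrite invr_gt0.
  - by move=> _ [[l kl <-] lx]; exists l.
exists phi.
  move=> A [N _ NA]; exists N => // k /= Nk; apply: NA => /=.
  exact: leq_trans Nk (phiP k).1.
apply/cvg_ballP => e e0; near=> k.
apply: le_ball (phiP k).2; apply: ltW.
by near: k; exact: (near_infty_natSinv_lt (PosNum e0)).
Unshelve. all: by end_near. Qed.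

(* The defect in the convexity of the squared norm gives
   [|x_(k+1) - p|^2 <= |x_k - p|^2 - alpha_k (1 - alpha_k) |x_k - y_k|^2]. *)
Lemma krasnoselskii_mann m n (x y : nat -> 'M[R]_(m, n)) p
    (alpha : nat -> R) (a b : R) :
  0 < a -> b < 1 ->
  (\forall k \near \oo, a <= alpha k) -> (\forall k \near \oo, alpha k <= b) ->
  (forall k, x k.+1 = alpha k *: x k + (1 - alpha k) *: y k) ->
  (\forall k \near \oo,
    frob_dot (y k - p) (y k - p) <= frob_dot (x k - p) (x k - p)) ->
  entrywise_cvg (fun k => x k - y k) 0.
Proof.
move=> a0 b1 aalpha alphab xS yp.
pose d k := frob_dot (x k - p) (x k - p).
pose e k := frob_dot (x k - y k) (x k - y k).
have dE k : d k.+1 = alpha k * d k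
    + (1 - alpha k) * frob_dot (y k - p) (y k - p)
    - alpha k * (1 - alpha k) * e k.
  have -> : d k.+1 = frob_dot
      (alpha k *: (x k - p) + (1 - alpha k) *: (y k - p))
      (alpha k *: (x k - p) + (1 - alpha k) *: (y k - p)).
    rewrite /d xS; congr (frob_dot _ _);
      by apply/matrixP => i j; rewrite !mxE; ring.
  rewrite /e.
  have -> : x k - y k = (x k - p) - (y k - p).
    by apply/matrixP => i j; rewrite !mxE; ring.
  rewrite /d; move: (x k - p) (y k - p) => u v; rewrite !frob_dotE.
  rewrite (frob_dotC v u); ring.
have dS : \forall k \near \oo, a * (1 - b) * e k <= d k - d k.+1.
  near=> k.
  have ak : a <= alpha k by near: k.
  have kb : alpha k <= b by near: k.
  have yk : frob_dot (y k - p) (y k - p) <= d k by near: k.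
  have ek : 0 <= e k := frob_dot_ge0 _.
  have : a * (1 - b) * e k <= alpha k * (1 - alpha k) * e k.
    by rewrite ler_wpM2r// ler_pM ?subr_ge0 ?lerD2l ?lerN2 // ltW.
  rewrite dE; nra.
(* The distances to [p] decrease only from some [n0] on, so monotone convergence is applied to the
   shifted sequence. *)
have [l dl] : exists l : R, d k @[k --> \oo] --> l.
  case: dS => n0 _ dS.
  suff : cvgn (fun k => d (k + n0)%N).
    by move=> dn0; eexists; rewrite -(cvg_shiftn n0); exact: dn0.
  apply: nonincreasing_is_cvgn.
    apply/nonincreasing_seqP => k; rewrite addSn -subr_ge0.
    apply: le_trans (dS (k + n0)%N _); last by rewrite /= leq_addl.
    by rewrite !mulr_ge0 ?frob_dot_ge0 ?subr_ge0 ?ltW.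
  by exists 0 => _ [k _ <-]; exact: frob_dot_ge0.
apply: cvg_frob_entrywise0.
(* Consecutive differences of the convergent sequence [d] tend to 0 and dominate [e] up to the
   constant [a * (1 - b)]. *)
apply: (@squeeze_cvgr _ _ _ _ (fun=> 0)
    (fun k => (a * (1 - b))^-1 * (d k - d k.+1))).
- apply: filterS dS => k dS; rewrite frob_dot_ge0 /=.
  by rewrite ler_pdivlMl// mulr_gt0// subr_gt0.
- exact: cvg_cst.
- rewrite -[X in _ --> X](mulr0 (a * (1 - b))^-1) -(subrr l).
  by apply: cvgMr; apply: cvgB => //; rewrite (cvg_shiftS d).
Unshelve. all: by end_near. Qed.

Lemma projected_gradient_limit m n (x y g : nat -> 'M[R]_(m, n))
    (s : nat -> R) c z G Q :
  0 < c -> (\forall k \near \oo, c <= s k) ->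
  (forall k, frob_dot (x k - s k *: g k - y k) (Q - y k) <= 0) ->
  entrywise_cvg (fun k => x k - y k) 0 -> entrywise_cvg x z ->
  entrywise_cvg g G ->
  0 <= frob_dot (Q - z) G.
Proof.
move=> c0 cs proj xy xz gG.
have yz : entrywise_cvg (fun k => Q - y k) (Q - z).
  apply: entrywise_cvgB; first exact: entrywise_cvg_cst.
  have -> : y = fun k => x k - (x k - y k).
    by apply/funext => k; rewrite opprB addrC subrK.
  by rewrite -[z]subr0; exact: entrywise_cvgB.
pose h k := frob_dot (x k - y k) (Q - y k).
have h0 : h k @[k --> \oo] --> 0.
  have -> : 0 = frob_dot 0 (Q - z).
    by rewrite -[0 in RHS](scale0r 0) frob_dotZl mul0r.
  exact: cvg_frob_dot.
(* The steps are bounded only from below, so the error [h k / s k] is controlled by [c^-1 * |h k|].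
   Adding this vanishing term makes the sequence eventually nonnegative and keeps its limit. *)
apply: (@cvgr_to_ge _ \oo _ _
  (fun k => frob_dot (Q - y k) (g k) + c^-1 * `|h k| : R)).
  rewrite -[frob_dot (Q - z) G]addr0 -(mulr0 c^-1) -(normr0 R).
  apply: cvgD; first exact: cvg_frob_dot.
  by apply: cvgMr; exact: cvg_norm.
near=> k.
have ck : c <= s k by near: k.
have sk := lt_le_trans c0 ck.
have := proj k.
have -> : x k - s k *: g k - y k = (x k - y k) - s k *: g k by rewrite addrAC.
rewrite frob_dotDl frob_dotNl frob_dotZl -/(h k) (frob_dotC (g k)) => hk.
have hg : - `|h k| <= s k * frob_dot (Q - y k) (g k).
  have := ler_norm (- h k); rewrite normrN; lra.
rewrite -(pmulr_rge0 _ sk) mulrDr mulrA.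
have : `|h k| <= s k / c * `|h k|.
  by rewrite ler_peMl// ler_pdivlMr// mul1r.
lra.
Unshelve. all: by end_near. Qed.

End limits.

(** The increment is [x k - y k] scaled by a factor of absolute value at most 1. This serves to
    replace [H n] by [H n.+1] in limits. *)
Lemma relaxation_step_cvg0 {R : realType} m n (x y : nat -> 'M[R]_(m, n))
    (alpha : nat -> R) :
  (forall k, 0 <= alpha k <= 1) ->
  (forall k, x k.+1 = alpha k *: x k + (1 - alpha k) *: y k) ->
  entrywise_cvg (fun k => x k - y k) 0 ->
  entrywise_cvg (fun k => x k.+1 - x k) 0.
Proof.
move=> alpha01 xS xy i j; rewrite mxE; apply/cvgr0Pnorm_lt => e e0.
have := xy i j; rewrite mxE => /cvgr0Pnorm_lt/(_ e e0).
apply: filterS => k; apply: le_lt_trans.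
have -> : x k.+1 - x k = - (1 - alpha k) *: (x k - y k).
  by rewrite xS; apply/matrixP => p q; rewrite !mxE; ring.
have /andP[a0 a1] := alpha01 k.
rewrite mxE normrM normrN (@ger0_norm _ (1 - alpha k)) ?subr_ge0//.
by rewrite ler_piMl// gerBl.
Qed.

(** * Nonexpansiveness of the two NMF maps and continuity of the gradients *)

Section nmf_steps.
Context {R : realType} {M N r : nat} (V : 'M[R]_(M, N)).

Lemma step_size_trmx m n (A : 'M[R]_(m, n)) s :
  step_size A s -> step_size A^T s.
Proof.
rewrite /step_size trmx_eq0; case: ifP => // _.
by rewrite trmxK /frob_norm frob_dot_mul_tr.
Qed.

(** The gradient in [H] is affine with linear part [W^T W], so [V] cancels in the difference and a
    gradient step of [H - H'] remains. *)
Lemma nmf_T_contraction s (W : 'M[R]_(M, r)) (H H' : 'M[R]_(r, N)) :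
  step_size W s ->
  frob_dot (nmf_T V s W H - nmf_T V s W H') (nmf_T V s W H - nmf_T V s W H')
  <= frob_dot (H - H') (H - H').
Proof.
move=> sW; apply: le_trans (metric_proj_nonneg_contraction _ _) _.
have -> : H - s *: nmf_gradH V W H - (H' - s *: nmf_gradH V W H') =
    (H - H') - s *: (W^T *m (W *m (H - H'))).
  have -> : W^T *m (W *m (H - H')) = nmf_gradH V W H - nmf_gradH V W H'.
    rewrite /nmf_gradH -mulmxBr; congr (_ *m _).
    by rewrite mulmxBr opprB addrA subrK.
  by apply/matrixP => i j; rewrite !mxE; ring.
exact: gradient_step_contraction.
Qed.

(** Transposition turns right multiplication by [H H^T] into left multiplication, so the same
    contraction applies with [H^T] as the matrix. *)
Lemma nmf_S_contraction s (H : 'M[R]_(r, N)) (W W' : 'M[R]_(M, r)) :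
  step_size H s ->
  frob_dot (nmf_S V s H W - nmf_S V s H W') (nmf_S V s H W - nmf_S V s H W')
  <= frob_dot (W - W') (W - W').
Proof.
move=> sH; apply: le_trans (metric_proj_nonneg_contraction _ _) _.
rewrite -frob_dot_trmx -(frob_dot_trmx (W - W')).
have -> : (W - s *: nmf_gradW V W H - (W' - s *: nmf_gradW V W' H))^T =
    (W - W')^T - s *: (H^T^T *m (H^T *m (W - W')^T)).
  have -> : H^T^T *m (H^T *m (W - W')^T) =
      (nmf_gradW V W H - nmf_gradW V W' H)^T.
    rewrite -!trmx_mul /nmf_gradW -mulmxBl; congr (_ *m _)^T.
    by rewrite mulmxBl opprB addrA subrK.
  by apply/matrixP => i j; rewrite !mxE; ring.
by apply: gradient_step_contraction; exact: step_size_trmx.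
Qed.

Lemma entrywise_cvg_nmf_gradW W H A B :
  entrywise_cvg W A -> entrywise_cvg H B ->
  entrywise_cvg (fun k => nmf_gradW V (W k) (H k) : 'M[R]_(M, r))
    (nmf_gradW V A B).
Proof.
move=> WA HB.
exact: (entrywise_cvg_mulmx (entrywise_cvgB (entrywise_cvg_mulmx WA HB)
  (@entrywise_cvg_cst _ _ _ V)) (entrywise_cvg_trmx HB)).
Qed.

Lemma entrywise_cvg_nmf_gradH W H A B :
  entrywise_cvg W A -> entrywise_cvg H B ->
  entrywise_cvg (fun k => nmf_gradH V (W k) (H k) : 'M[R]_(r, N))
    (nmf_gradH V A B).
Proof.
move=> WA HB.
exact: (entrywise_cvg_mulmx (entrywise_cvg_trmx WA)
  (entrywise_cvgB (entrywise_cvg_mulmx WA HB) (@entrywise_cvg_cst _ _ _ V))).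
Qed.

End nmf_steps.

(** * Feasibility and the variational inequality at accumulation points *)

Lemma nonneg_mx_convex {R : realType} m n (a : R) (A B : 'M[R]_(m, n)) :
  0 <= a <= 1 -> nonneg_mx A -> nonneg_mx B ->
  nonneg_mx (a *: A + (1 - a) *: B).
Proof.
move=> /andP[a0 a1] A0 B0 i j.
by rewrite !mxE addr_ge0// mulr_ge0// subr_ge0.
Qed.

Lemma nonneg_mx_entrywise_cvg {R : realType} m n (A : nat -> 'M[R]_(m, n)) B :
  (forall k, nonneg_mx (A k)) -> entrywise_cvg A B -> nonneg_mx B.
Proof.
move=> A0 AB i j; apply: cvgr_to_ge (AB i j) _.
by apply: nearW => k; exact: A0.
Qed.

Unset Implicit Arguments.

Theorem theorem3p1 (R : realType) (M N r : nat)
    (r_gt0 : (1 <= r)%N) (r_lt : (r < minn M N)%N)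
    (V : 'M[R]_(M, N)) (V_ge0 : nonneg_mx V)
    (alpha beta mu lambda : nat -> R)
    (W : nat -> 'M[R]_(M, r)) (H : nat -> 'M[R]_(r, N))
    (alg : nmf_fixed_point_algorithm V alpha beta mu lambda W H)
    (A : exists m0 : nat,
      (\bigcap_(n in [set n | (m0 <= n)%N])
          fixed_points (nmf_S V (lambda n) (H n.+1))) !=set0 /\
      (\bigcap_(n in [set n | (m0 <= n)%N])
          fixed_points (nmf_T V (mu n) (W n))) !=set0)
    (C1_alpha : (0 < limn_einf (EFin \o alpha)
                   <= limn_esup (EFin \o alpha))%E /\
                (limn_esup (EFin \o alpha) < 1)%E)
    (C1_beta : (0 < limn_einf (EFin \o beta)
                  <= limn_esup (EFin \o beta))%E /\
               (limn_esup (EFin \o beta) < 1)%E)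
    (C2_mu : (0 < limn_einf (EFin \o mu))%E)
    (C2_lambda : (0 < limn_einf (EFin \o lambda))%E)
    (X : 'M[R]_(M, r) * 'M[R]_(r, N))
    (X_acc : cluster ((fun n => (W n, H n)) @ \oo) X) :
  VI (@nonneg_mx R M r `*` @nonneg_mx R r N) (nmf_grad V) X.
Proof.
case: alg => alpha01 beta01 H0 W0 muP HS lambdaP WS.
case: A => m0 [[Ws Wfix] [Hs Hfix]].
case: C1_alpha C1_beta => /andP[alpha_gt _] alpha_lt [/andP[beta_gt _] beta_lt].
have [a0 a0_gt alpha_ge] := limn_einf_gt_near alpha_gt.
have [a1 a1_lt alpha_le] := limn_esup_lt_near alpha_lt.
have [b0 b0_gt beta_ge] := limn_einf_gt_near beta_gt.
have [b1 b1_lt beta_le] := limn_esup_lt_near beta_lt.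
have [c c_gt mu_ge] := limn_einf_gt_near C2_mu.
have [d d_gt lambda_ge] := limn_einf_gt_near C2_lambda.
pose T n := nmf_T V (mu n) (W n) (H n).
pose S n := nmf_S V (lambda n) (H n.+1) (W n).
have HT : entrywise_cvg (fun n => H n - T n) 0.
  apply: (krasnoselskii_mann (p := Hs) a0_gt a1_lt alpha_ge alpha_le) => //.
  (* Only the occurrences of [Hs] on the left become its image under the map, which leaves plain
     nonexpansiveness. *)
  exists m0 => // n m0n; rewrite /= -{1 2}(Hfix n m0n).
  exact: nmf_T_contraction.
have WS0 : entrywise_cvg (fun n => W n - S n) 0.
  apply: (krasnoselskii_mann (p := Ws) b0_gt b1_lt beta_ge beta_le) => //.
  exists m0 => // n m0n; rewrite /= -{1 2}(Wfix n m0n).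
  exact: nmf_S_contraction.
have H_ge0 n : nonneg_mx (H n).
  elim: n => // n IH; rewrite HS; apply: nonneg_mx_convex => //.
  exact: (metric_proj_nonnegP _).1.
have W_ge0 n : nonneg_mx (W n).
  elim: n => // n IH; rewrite WS; apply: nonneg_mx_convex => //.
  exact: (metric_proj_nonnegP _).1.
have [phi phioo phiX] := cluster_cvg_subseq X_acc.
have WX : entrywise_cvg (W \o phi) X.1.
  by apply: cvg_entrywise; exact: (cvg_comp _ _ phiX cvg_fst).
have HX : entrywise_cvg (H \o phi) X.2.
  by apply: cvg_entrywise; exact: (cvg_comp _ _ phiX cvg_snd).
(* The [W] update uses the gradient at [H n.+1], so the subsequence shifted by one must have the
   same limit. *)
have HSX : entrywise_cvg (fun k => H (phi k).+1) X.2.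
  have -> : (fun k => H (phi k).+1) =
      fun k => H (phi k) + (H (phi k).+1 - H (phi k)).
    by apply/funext => k; rewrite addrC subrK.
  rewrite -[X.2]addr0; apply: entrywise_cvgD => //.
  exact: (entrywise_cvg_comp phioo (relaxation_step_cvg0 alpha01 HS HT)).
split.
  by split; [apply: nonneg_mx_entrywise_cvg WX => k; exact: W_ge0
            |apply: nonneg_mx_entrywise_cvg HX => k; exact: H_ge0].
(* Since the constraint set is a product, each block is treated separately with its own step
   sizes. *)
move=> Y [Y1 Y2]; rewrite /pair_dot /=; apply: addr_ge0.
- apply: (projected_gradient_limit (x := W \o phi) (y := S \o phi)
    (g := fun k => nmf_gradW V (W (phi k)) (H (phi k).+1))
    (s := lambda \o phi) d_gt _ _ _ WX _).
  + exact: (phioo _ lambda_ge).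
  + by move=> k; exact: (metric_proj_nonnegP _).2.
  + exact: (entrywise_cvg_comp phioo WS0).
  + exact: (entrywise_cvg_nmf_gradW WX HSX).
- apply: (projected_gradient_limit (x := H \o phi) (y := T \o phi)
    (g := fun k => nmf_gradH V (W (phi k)) (H (phi k)))
    (s := mu \o phi) c_gt _ _ _ HX _).
  + exact: (phioo _ mu_ge).
  + by move=> k; exact: (metric_proj_nonnegP _).2.
  + exact: (entrywise_cvg_comp phioo HT).
  + exact: (entrywise_cvg_nmf_gradH WX HX).
Qed.
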